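(* Let $G$ and $H$ be finite simple connected graphs, neither of which is a complete graph. Then $tn(G\boxtimes H)=2$ if and only if there exist two different non-adjacent vertices $(x_1,y_1),(x_2,y_2)\in V(G\boxtimes H)$ such that (1) for any $(x,y)\in N((x_1,y_1))$, $N[(x,y)]\nsubseteq N[(x_1,y_1)]$, and (2) for any $(x,y)\in N((x_2,y_2))$, $N[(x,y)]\nsubseteq N[(x_2,y_2)]$.
   Context: $N(v)$ denotes the open neighborhood and $N[v]=N(v)\cup\{v\}$ the closed neighborhood of a vertex $v$ (here in $G\boxtimes H$). The strong product $G\boxtimes H$ has vertex set $V(G)\times V(H)$; $(g_1,h_1)$ and $(g_2,h_2)$ are adjacent iff ($g_1g_2\in E(G)$ and $h_1=h_2$) or ($g_1=g_2$ and $h_1h_2\in E(H)$) or ($g_1g_2\in E(G)$ and $h_1h_2\in E(H)$). For two different non-adjacent vertices $u,v$ of a graph $F$, a tolled walk between $u$ and $v$ is a sequence of vertices $u,w_1,\dots,w_k,v$ with $k\ge 1$ such that consecutive vertices of $w_1,\dots,w_k$ are adjacent, $uw_i\in E(F)$ if and only if $i=1$, and $vw_i\in E(F)$ if and only if $i=k$. If $uv\in E(F)$, the only tolled walk between $u$ and $v$ is $u,v$; the only tolled walk from $v$ to itself is the single vertex $v$. The toll interval $T_F(u,v)$ is the set of all vertices of $F$ lying on some tolled walk between $u$ and $v$. For $S\subseteq V(F)$ the toll closure is $T_F[S]=\bigcup_{u,v\in S}T_F(u,v)$. $S$ is a toll set of $F$ if $T_F[S]=V(F)$, and the toll number $tn(F)$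 is the minimum size of a toll set of $F$. *)

(* Defs.v *)
From mathcomp Require Import all_boot.
From mathcomp Require Import boolp.

Set Implicit Arguments.
Unset Strict Implicit.
Unset Printing Implicit Defensive.

(* A finite simple graph is an adjacency relation [e : rel T] on [T : finType]
   satisfying [simple_graph e]. *)

Section Graph.
Variables (T : finType) (e : rel T).

Definition simple_graph : Prop := symmetric e /\ irreflexive e.

(* Connected graphs are nonempty. *)
Definition connected_graph : Prop := 0 < #|T| /\ forall x y : T, connect e x y.

Definition complete_graph : Prop := forall x y : T, x != y -> e x y.

Definition open_nbh (v : T) : {set T} := [set w | e v w].

Definition closed_nbh (v : T) : {set T} := v |: open_nbh v.

(* [w] lists the interior vertices w_1, ..., w_k, which are indexed from 0
   below: w_1 is item 0 and w_k is item [(size w).-1]. *)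
Definition tolled_interior (u v : T) (w : seq T) : Prop :=
  [/\ 0 < size w,
      sorted e w,
      forall i, i < size w -> e u (nth u w i) = (i == 0)
    & forall i, i < size w -> e v (nth v w i) = (i == (size w).-1)].

(* [s] is the whole vertex sequence of the walk, both ends included. *)
Definition tolled_walk (u v : T) (s : seq T) : Prop :=
  if u == v then s = [:: v]
  else if e u v then s = [:: u; v]
  else exists2 w, tolled_interior u v w & s = u :: rcons w v.

(* Tolled walks have no a priori length bound, hence the classical [asbool]. *)
Definition toll_interval (u v : T) : {set T} :=
  [set x | `[< exists2 s, tolled_walk u v s & x \in s >]].

Definition toll_closure (S : {set T}) : {set T} :=
  \bigcup_(u in S) \bigcup_(v in S) toll_interval u v.

Definition toll_set (S : {set T}) : bool := toll_closure S == [set: T].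

Lemma toll_setT : toll_set [set: T].
Proof.
apply/eqP/setP => x; rewrite inE; apply/bigcupP; exists x => //.
apply/bigcupP; exists x => //; rewrite inE; apply/asboolP.
by exists [:: x]; rewrite ?mem_head // /tolled_walk eqxx.
Qed.

(* The minimum ranges over a nonempty family by [toll_setT]. *)
Definition toll_number : nat :=
  #|[arg min_(S < [set: T] | toll_set S) #|S|]|.

End Graph.

Definition strong_prod (G H : finType) (eG : rel G) (eH : rel H) :
  rel (G * H) := fun p q =>
  [|| eG p.1 q.1 && (p.2 == q.2),
      (p.1 == q.1) && eH p.2 q.2
    | eG p.1 q.1 && eH p.2 q.2].

(* Main.v *)
Require Import Defs.
From mathcomp Require Import all_boot.
From mathcomp Require Import boolp zify.

Set Implicit Arguments.
Unset Strict Implicit.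
Unset Printing Implicit Defensive.

(** If [{u, v}] is a toll set, a neighbor [x] of [u] is the first interior
    vertex of some tolled walk, and the vertex following [x] witnesses that
    [N[x]] is not contained in [N[u]].  Conversely, condition (1) forces both
    coordinates of [u] to be non-universal (otherwise a vertex in the same
    fiber as [u] is dominated by [u]), and then the complement of
    [N[u] = N[x1] x N[y1]] is connected in the strong product; likewise for
    [v].  Every [x] is thus reached from [u] off [N[v]] and from [v] off [N[u]];
    cutting both paths at their last vertex in [N(u)], resp. [N(v)], and gluing
    them at [x] gives a tolled walk through [x]. *)

(** Serves to carry paths of one factor into a fiber of the product. *)
Lemma homo_connect (T U : finType) (e : rel T) (r : rel U) (f : T -> U) :
  (forall a b, e a b -> r (f a) (f b)) ->
  forall a b, connect e a b -> connect r (f a) (f b).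
Proof.
move=> ef a b /connectP[p + ->] {b}.
elim: p a => [|c p IH] a /=; first by rewrite connect0.
by case/andP=> /ef/connect1 rac /IH; apply: connect_trans.
Qed.

(** * Tolled walks: endpoint conditions, cutting and gluing *)

Section Toll.
Variables (T : finType) (e : rel T).
Hypotheses (e_sym : symmetric e) (e_irr : irreflexive e).

(** Adjacency of the graph with [C] deleted, kept on the full type so that [connect] applies without
    a subtype. *)
Definition off (C : {set T}) : rel T :=
  [rel a b | [&& e a b, a \notin C & b \notin C]].

Definition undominated (u : T) : Prop :=
  forall x, x \in open_nbh e u -> ~~ (closed_nbh e x \subset closed_nbh e u).

Definition connected_off_nbh (u : T) : Prop :=
  forall a b, a \notin closed_nbh e u -> b \notin closed_nbh e u ->
    connect (off (closed_nbh e u)) a b.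

Lemma in_closed_nbh u x : (x \in closed_nbh e u) = (x == u) || e u x.
Proof. by rewrite !inE. Qed.

(** One endpoint's share of the tolled-walk condition, free of indices. The other endpoint uses it
    on the reversed list, so both ends share the same lemmas. *)
Definition only_head (u : T) (w : seq T) : bool :=
  if w is a :: t then e u a && all (fun z => ~~ e u z) t else false.

Lemma only_head_cat u w t :
  only_head u w -> all (fun z => ~~ e u z) t -> only_head u (w ++ t).
Proof. by case: w => //= a w /andP[-> aw] ht; rewrite all_cat aw. Qed.

Lemma only_headP u v w :
  reflect (0 < size w /\ forall i, i < size w -> e u (nth v w i) = (i == 0))
          (only_head u w).
Proof.
case: w => [|a t] /=; first by constructor; case.
apply: (iffP andP) => [[ua /(all_nthP v) at_]|[_ H]].
  by split=> // -[|i] //= it; apply/negbTE/at_.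
split; first by rewrite (H 0).
by apply/(all_nthP v) => i it; rewrite (H i.+1).
Qed.

Lemma tolled_interiorP u v w :
  tolled_interior e u v w <->
  [/\ sorted e w, only_head u w & only_head v (rev w)].
Proof.
split=> [[w0 sw hu hv]|[sw /(only_headP _ u)[w0 hu] /(only_headP _ v)[_]]].
  split=> //; first exact/(only_headP _ u).
  apply/(only_headP _ v); rewrite size_rev; split=> // i iw.
  by rewrite nth_rev // hv; lia.
rewrite size_rev => hv; split=> // i iw.
have := hv (size w - i.+1); rewrite nth_rev; last by lia.
have -> : size w - (size w - i.+1).+1 = i by lia.
by move=> ->; lia.
Qed.

(** Among interior vertices only the first is adjacent to [u], so [x] is that one. The vertex after
    it on the walk, which is [v] if the interior is a single vertex, lies outside [N[u]]. *)
Lemma tolled_undominated u v w x :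
    u != v -> ~~ e u v ->
    sorted e w -> only_head u w -> only_head v (rev w) ->
  x \in w -> e u x -> ~~ (closed_nbh e x \subset closed_nbh e u).
Proof.
move=> uv nuv sw hu hv xw ux; apply/subsetPn.
case: w sw hu hv xw => // a t sw /andP[_ nt] hv.
rewrite inE => /orP[/eqP xa|xt]; last by rewrite (negbTE (allP nt x xt)) in ux.
subst a; case: t sw nt hv => [|b t] /=.
  move=> _ _ /andP[vx _]; exists v; rewrite in_closed_nbh.
    by rewrite e_sym vx orbT.
  by rewrite eq_sym (negbTE uv).
case/andP=> xb bt /andP[nub nt] hv; exists b; rewrite in_closed_nbh.
  by rewrite xb orbT.
(* The walk might return to [u] at [b]. A further interior vertex would then be a second neighbor of
   [u]; without one, [u] is the last interior vertex and so adjacent to [v]. *)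
rewrite (negbTE nub) orbF; apply: contra nuv => /eqP bu; subst b.
case: t bt nt hv => [_ _|c t /andP[uc _] /andP[]]; last by rewrite uc.
by rewrite /rev /= e_sym => /andP[].
Qed.

(** Keep the part of the path from its last neighbor of [u] on. The endpoint [x] is split off from
    [s] because in the application it alone may lie in [N(v)]. *)
Lemma path_only_head u x a p :
    x != u -> path e a p -> last a p = x -> has (e u) (a :: p) ->
  exists s, [/\ sorted e (rcons s x), only_head u (rcons s x)
    & {subset s <= belast a p}].
Proof.
move=> xu; elim: p a => [|b p IH] a /=.
  by move=> _ ->; rewrite orbF => ux; exists [::]; rewrite /= ux; split.
case/andP=> ab bp lx; have [hb _|nb] := boolP (has (e u) (b :: p)).
  have [s [ss hs sub]] := IH b bp lx hb; exists s; split=> // z /sub zp.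
  by rewrite inE zp orbT.
rewrite -/(has (e u) (b :: p)) (negbTE nb) orbF => ua.
exists (a :: belast b p); rewrite rcons_cons -lx -lastI /= ab bp ua.
by split=> //; apply/(@allP _ _ (b :: p)) => z; apply: (hasPn nb).
Qed.

Lemma off_path (C : {set T}) a p :
  path (off C) a p -> a \notin C ->
  path e a p /\ {subset a :: p <= [predC C]}.
Proof.
elim: p a => [|b p IH] a /=; first by move=> _ aC; split=> // z /[!inE] /eqP->.
case/andP=> /and3P[ab _ bC] /IH/(_ bC)[bp sub] aC; rewrite ab; split=> // z.
by rewrite inE => /orP[/eqP->|/sub]; rewrite ?inE.
Qed.

Lemma half_walk u v x :
    u != v -> ~~ e u v -> connected_off_nbh v -> undominated v ->
    x != u -> x != v ->
  exists s, [/\ sorted e (rcons s x), only_head u (rcons s x)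
    & all (fun z => ~~ e v z) s].
Proof.
move=> uv nuv conn und xu xv.
have uC : u \notin closed_nbh e v by rewrite in_closed_nbh (negbTE uv) e_sym.
(* A path from [u] to [x] that avoids [N[v]] except possibly at [x]. *)
have [p [up lx sub]] : exists p, [/\ path e u p, last u p = x
    & {subset belast u p <= [predC (closed_nbh e v)]}].
  have [xC|xC] := boolP (x \in closed_nbh e v); last first.
    have /connectP[p /off_path/(_ uC)[up sub] ->] := conn u x uC xC.
    by exists p; split=> // z zp; apply: sub; apply: mem_belast.
  have vx : e v x by rewrite in_closed_nbh (negbTE xv) in xC.
  (* When [x] is in [N(v)], approach it through a neighbor [z] outside [N[v]]. *)
  have /subsetPn[z xz zC] : ~~ (closed_nbh e x \subset closed_nbh e v).
    by apply: und; rewrite inE.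
  have {}xz : e x z.
    move: xz; rewrite in_closed_nbh => /orP[/eqP zx|//].
    by rewrite zx xC in zC.
  have /connectP[p /off_path/(_ uC)[up sub] lz] := conn u z uC zC.
  by exists (rcons p x); rewrite rcons_path last_rcons up -lz e_sym xz belast_rcons.
(* The path leaves [u] because [x] differs from [u], so its second vertex is a neighbor of [u]. *)
have hp : has (e u) (u :: p).
  case: p up lx {sub} => [_ /eqP|b p /andP[ub _] _] /=.
    by rewrite eq_sym (negbTE xu).
  by rewrite ub orbT.
have [s [ss hs ssub]] := path_only_head xu up lx hp.
exists s; split=> //; apply/allP => z /ssub/sub; rewrite inE /= in_closed_nbh.
by case/norP.
Qed.

Lemma tolled_interior_exists u v x :
    u != v -> ~~ e u v ->
    connected_off_nbh u -> connected_off_nbh v ->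
    undominated u -> undominated v -> x != u -> x != v ->
  exists2 w, tolled_interior e u v w & x \in w.
Proof.
move=> uv nuv cu cv du dv xu xv.
have [s [ss hs av]] := half_walk uv nuv cv dv xu xv.
have [||t [st ht au]] := half_walk _ _ cu du xv xu; rewrite 1?eq_sym 1?e_sym //.
(* The vertex [x] belongs to both halves: the half from [u] controls its adjacency to [u], the half
   from [v] its adjacency to [v]. *)
exists (rcons s x ++ rev t).
  apply/tolled_interiorP; split.
  - have : sorted e (rev (rcons t x)).
      by rewrite rev_sorted; apply: sub_sorted st => a b; rewrite e_sym.
    rewrite rev_rcons /=; case: (s) ss => [|a s'] //=.
    by rewrite cat_path last_rcons => -> ->.
  - by apply: only_head_cat; rewrite ?all_rev.
  - rewrite rev_cat revK rev_rcons -cat_rcons.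
    by apply: only_head_cat; rewrite ?all_rev.
by rewrite mem_cat mem_rcons mem_head.
Qed.

(** * Toll sets with two elements *)

Lemma toll_interval_refl u : toll_interval e u u = [set u].
Proof.
apply/setP=> x; rewrite !inE; apply/asboolP/idP; rewrite /tolled_walk eqxx.
  by case=> s -> /[!inE].
by exists [:: u]; rewrite ?inE.
Qed.

Lemma toll_set_pair u v :
    u != v -> ~~ e u v ->
    connected_off_nbh u -> connected_off_nbh v ->
    undominated u -> undominated v ->
  toll_set e [set u; v].
Proof.
move=> uv nuv cu cv du dv; apply/eqP/setP => x; rewrite inE.
have [xuv|] := boolP (x \in [set u; v]).
  apply/bigcupP; exists x => //; apply/bigcupP; exists x => //.
  by rewrite toll_interval_refl inE.
rewrite !inE => /norP[xu xv].
have [w uvw xw] := tolled_interior_exists uv nuv cu cv du dv xu xv.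
apply/bigcupP; exists u; first by rewrite !inE eqxx.
apply/bigcupP; exists v; first by rewrite !inE eqxx orbT.
rewrite inE; apply/asboolP; rewrite /tolled_walk (negbTE uv) (negbTE nuv).
by exists (u :: rcons w v); [exists w | rewrite inE mem_rcons inE xw !orbT].
Qed.

Lemma tolled_interior_rev u v w :
  tolled_interior e u v w -> tolled_interior e v u (rev w).
Proof.
case/tolled_interiorP=> sw hu hv; apply/tolled_interiorP; rewrite revK.
by split=> //; rewrite rev_sorted; apply: sub_sorted sw => a b; rewrite e_sym.
Qed.

(** The intervals of [u] and of [v] with themselves are singletons, so [x] lies on a walk between
    the two; one that runs from [v] to [u] is reversed. *)
Lemma toll_set_pair_interior u v x :
    u != v -> ~~ e u v -> toll_set e [set u; v] -> x != u -> x != v ->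
  exists2 w, tolled_interior e u v w & x \in w.
Proof.
move=> uv nuv /eqP/setP/(_ x); rewrite [RHS]inE => /bigcupP[a ain].
case/bigcupP=> b bin xab xu xv; move: xab.
have vu : v != u by rewrite eq_sym.
have nvu : ~~ e v u by rewrite e_sym.
case/set2P: ain => ->; case/set2P: bin => ->;
  rewrite ?toll_interval_refl ?inE ?(negbTE xu) ?(negbTE xv) // => /asboolP[s].
- rewrite /tolled_walk (negbTE uv) (negbTE nuv) => -[w uvw ->].
  by rewrite inE mem_rcons inE (negbTE xu) (negbTE xv); exists w.
- rewrite /tolled_walk (negbTE vu) (negbTE nvu) => -[w vuw ->].
  rewrite inE mem_rcons inE (negbTE xu) (negbTE xv) => xw; exists (rev w).
    exact: tolled_interior_rev.
  by rewrite mem_rev.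
Qed.

Lemma toll_set_pair_undominated u v :
  u != v -> ~~ e u v -> toll_set e [set u; v] -> undominated u.
Proof.
move=> uv nuv tuv x; rewrite inE => ux.
have xu : x != u by apply: contraTneq ux => ->; rewrite e_irr.
have xv : x != v by apply: contraTneq ux => ->.
have [w /tolled_interiorP[sw hu hv] xw] :=
  toll_set_pair_interior uv nuv tuv xu xv.
exact: tolled_undominated uv nuv sw hu hv xw ux.
Qed.

(** If [u] and [v] were adjacent, every tolled walk between them would stay in [[set u; v]], which
    is too small to be the whole graph. *)
Lemma toll_set_pair_nonadjacent u v :
  2 < #|T| -> u != v -> toll_set e [set u; v] -> ~~ e u v.
Proof.
move=> T2 uv /eqP tuv; apply/negP => uv_e.
suff : [set: T] \subset [set u; v].
  by move/subset_leq_card; rewrite cardsT cards2 uv; lia.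
rewrite -tuv; apply/bigcupsP => a ain; apply/bigcupsP => b bin.
apply/subsetP => x; rewrite inE => /asboolP[s]; rewrite /tolled_walk.
have [_ ->|ab] := eqVneq a b; first by rewrite inE => /eqP->.
have -> : e a b.
  by move: ab; case/set2P: ain => ->; case/set2P: bin => ->;
    rewrite ?eqxx // e_sym.
by move=> ->; rewrite !inE => /orP[]/eqP->; rewrite -in_set2.
Qed.

(** A set with at most one element is not enlarged by its toll closure. *)
Lemma toll_set_card_gt1 S : 1 < #|T| -> toll_set e S -> 1 < #|S|.
Proof.
move=> T1 /eqP tS; rewrite ltnNge; apply/negP => /card_le1_eqP S1.
have : [set: T] \subset S.
  rewrite -tS; apply/bigcupsP => a aS; apply/bigcupsP => b bS.
  by rewrite (S1 b a) // toll_interval_refl sub1set.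
move/subsetP => ST; have /card_gt1P[a [b [_ _ /eqP]]] := T1; case.
by apply: S1; apply: ST; rewrite inE.
Qed.

Lemma toll_number_eq2P :
  2 < #|T| ->
  toll_number e = 2 <-> exists u v, u != v /\ toll_set e [set u; v].
Proof.
move=> T2; rewrite /toll_number; case: arg_minnP => [|S tS minS].
  exact: toll_setT.
split=> [/eqP/cards2P[u [v [uv defS]]]|[u [v [uv tuv]]]].
  by exists u, v; rewrite -defS.
apply/eqP; rewrite eqn_leq toll_set_card_gt1 //; last exact: ltnW.
by have := minS _ tuv; rewrite cards2 uv => ->.
Qed.

End Toll.

(** * Non-complete graphs and universal vertices *)

Lemma noncomplete_nonadjacent (T : finType) (e : rel T) :
  ~ complete_graph e -> exists a b, a != b /\ ~~ e a b.
Proof.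
move=> nc; apply: contrapT => H; apply: nc => a b ab.
by apply: contrapT => /negP nab; apply: H; exists a, b.
Qed.

Lemma noncomplete_card (T : finType) (e : rel T) :
  ~ complete_graph e -> 1 < #|T|.
Proof.
case/noncomplete_nonadjacent=> a [b [ab _]].
by apply/card_gt1P; exists a, b.
Qed.

(** If [N[x]] were everything, any vertex other than [x] would be a neighbor dominated by [x]. *)
Lemma undominated_nonuniversal (T : finType) (e : rel T) x :
  1 < #|T| -> undominated e x -> exists z, z \notin closed_nbh e x.
Proof.
move=> T1 und; apply: contrapT => nfull.
have full z : z \in closed_nbh e x.
  by apply: contrapT => /negP zx; apply: nfull; exists z.
have [z zx] : exists z, z != x.
  have /card_gt1P[a [b [_ _ ab]]] := T1.
  by have [ax|] := eqVneq a x; [exists b; rewrite -ax eq_sym | exists a].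
have xz : z \in open_nbh e x by move: (full z); rewrite !inE (negbTE zx).
by have /subsetPn[y _ /negP[]] := und z xz; apply: full.
Qed.

(** * Neighborhoods and connectivity in the strong product *)

Section StrongProduct.
Variables (G H : finType) (eG : rel G) (eH : rel H).
Hypotheses (symG : symmetric eG) (irrG : irreflexive eG).
Hypotheses (symH : symmetric eH) (irrH : irreflexive eH).
Local Notation GH := (strong_prod eG eH).

Lemma strong_prod_sym : symmetric GH.
Proof.
by move=> p q; rewrite /strong_prod symG symH ![_ == q.2]eq_sym ![_ == q.1]eq_sym.
Qed.

Lemma strong_prod_irr : irreflexive GH.
Proof. by move=> p; rewrite /strong_prod irrG irrH andbF. Qed.

(** The three clauses of adjacency list the ways in which each coordinate is equal or adjacent,
    short of both being equal. *)
Lemma closed_nbh_strong_prod x y x' y' :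
  ((x', y') \in closed_nbh GH (x, y)) =
  (x' \in closed_nbh eG x) && (y' \in closed_nbh eH y).
Proof.
rewrite !in_closed_nbh /strong_prod /= xpair_eqE.
rewrite [x == x']eq_sym [y == y']eq_sym.
by do 2!case: eqP => _ /=; case: eG => //=; case: eH.
Qed.

(** A pair is outside the box [N[x] x N[y]] as soon as one coordinate is outside its side. Fixing
    such a coordinate gives a connected fiber that misses the box; two fiber moves then lead to
    [(g0, h0)]. *)
Lemma strong_prod_connected_off_nbh x y :
    (forall a b, connect eG a b) -> (forall a b, connect eH a b) ->
    (exists g, g \notin closed_nbh eG x) ->
    (exists h, h \notin closed_nbh eH y) ->
  connected_off_nbh GH (x, y).
Proof.
move=> connG connH [g0 g0x] [h0 h0y]; set C := closed_nbh GH (x, y).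
have symC : connect_sym (off GH C).
  apply: sym_connect_sym => p q.
  by rewrite /off /= strong_prod_sym [(p \notin C) && _]andbC.
have moveH g h h' : g \notin closed_nbh eG x ->
    connect (off GH C) (g, h) (g, h').
  move=> gx; apply: (@homo_connect _ _ eH _ (pair g)) => // a b ab.
  rewrite /off /= !closed_nbh_strong_prod (negbTE gx) /=.
  by rewrite /strong_prod /= eqxx ab orbT.
have moveG g g' h : h \notin closed_nbh eH y ->
    connect (off GH C) (g, h) (g', h).
  move=> hy; apply: (@homo_connect _ _ eG _ (pair^~ h)) => // a b ab.
  rewrite /off /= !closed_nbh_strong_prod (negbTE hy) !andbF /=.
  by rewrite /strong_prod /= eqxx ab.
have to0 p : p \notin C -> connect (off GH C) p (g0, h0).
  case: p => g h; rewrite closed_nbh_strong_prod negb_and => /orP[gx|hy].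
    exact: connect_trans (moveH _ _ h0 gx) (moveG _ _ _ h0y).
  exact: connect_trans (moveG _ g0 _ hy) (moveH _ _ _ g0x).
move=> p q /to0 p0 /to0 q0; apply: connect_trans p0 _.
by rewrite symC.
Qed.

(** A neighbor [z] dominated by one coordinate gives a dominated neighbor of [(x, y)] in the fiber
    through it, since closed neighborhoods are products. *)
Lemma undominated_strong_prod x y :
  undominated GH (x, y) -> undominated eG x /\ undominated eH y.
Proof.
move=> und; split=> z; rewrite inE => adj; apply/negP => /subsetP sub.
  have /subsetP[] :
      ~~ (closed_nbh GH (z, y) \subset closed_nbh GH (x, y)).
    by apply: und; rewrite inE /strong_prod /= adj eqxx.
  case=> g h; rewrite !closed_nbh_strong_prod => /andP[/sub-> ->] //.
have /subsetP[] : ~~ (closed_nbh GH (x, z) \subset closed_nbh GH (x, y)).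
  by apply: und; rewrite inE /strong_prod /= adj eqxx orbT.
by case=> g h; rewrite !closed_nbh_strong_prod => /andP[-> /sub->].
Qed.

End StrongProduct.

Theorem corollary4p7 (G H : finType) (eG : rel G) (eH : rel H)
    (simpleG : simple_graph eG) (simpleH : simple_graph eH)
    (connG : connected_graph eG) (connH : connected_graph eH)
    (ncomplG : ~ complete_graph eG) (ncomplH : ~ complete_graph eH) :
  let GH := strong_prod eG eH in
  toll_number GH = 2 <->
  exists (x1 : G) (y1 : H) (x2 : G) (y2 : H),
    [/\ (x1, y1) != (x2, y2),
        ~~ GH (x1, y1) (x2, y2),
        forall (x : G) (y : H), (x, y) \in open_nbh GH (x1, y1) ->
          ~~ (closed_nbh GH (x, y) \subset closed_nbh GH (x1, y1))
      & forall (x : G) (y : H), (x, y) \in open_nbh GH (x2, y2) ->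
          ~~ (closed_nbh GH (x, y) \subset closed_nbh GH (x2, y2))].
Proof.
move=> GH; case: simpleG simpleH => symG irrG [symH irrH].
have G1 := noncomplete_card ncomplG; have H1 := noncomplete_card ncomplH.
have symGH : symmetric GH := strong_prod_sym symG symH.
have irrGH : irreflexive GH := strong_prod_irr irrG irrH.
have GH2 : 2 < #|{: G * H}|.
  by rewrite card_prod; apply: (@leq_trans (2 * 2)) => //; apply: leq_mul.
(* Both coordinates inherit the condition, hence neither is universal. *)
have coGH x y : undominated GH (x, y) -> connected_off_nbh GH (x, y).
  case/undominated_strong_prod=> dx dy.
  apply: strong_prod_connected_off_nbh => //.
  - by case: connG.
  - by case: connH.
  - exact: undominated_nonuniversal.
  - exact: undominated_nonuniversal.
apply: (iff_trans (toll_number_eq2P GH GH2)).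
split=> [[[x1 y1] [[x2 y2] [uv tuv]]]|[x1 [y1 [x2 [y2 [uv nuv d1 d2]]]]]].
  have nuv := toll_set_pair_nonadjacent symGH GH2 uv tuv.
  exists x1, y1, x2, y2; split=> // x y.
    exact: (toll_set_pair_undominated symGH irrGH uv nuv tuv).
  (* The argument is symmetric in the two vertices of the pair. *)
  apply: (@toll_set_pair_undominated _ _ symGH irrGH _ (x1, y1)).
  - by rewrite eq_sym.
  - by rewrite symGH.
  - by rewrite setUC.
exists (x1, y1), (x2, y2); split=> //.
have {}d1 : undominated GH (x1, y1) by case=> x y; apply: d1.
have {}d2 : undominated GH (x2, y2) by case=> x y; apply: d2.
by apply: toll_set_pair => //; apply: coGH.
Qed.
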